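(* Let $-3<\alpha\le0$ and let $f\in S^*_{con}$, i.e. $f\in\mathscr{A}$ with $$\frac{zf'(z)}{f(z)}\prec\frac{3}{3+(\alpha-3)z-\alpha z^2}.$$ Then $$\|P_f\|\le\frac{2(6+\alpha)}{3+\alpha}.$$
   Context: $\mathbb{D}=\{z\in\mathbb{C}:|z|<1\}$. $\mathscr{A}$ is the class of analytic functions $f$ on $\mathbb{D}$ with $f(0)=0$, $f'(0)=1$. For analytic $g,h$ on $\mathbb{D}$, $g\prec h$ (subordination) means $g=h\circ\omega$ for some analytic $\omega:\mathbb{D}\to\mathbb{D}$ with $\omega(0)=0$. For $f\in\mathscr{A}$ with $f'\ne0$ in $\mathbb{D}$, $P_f(z)=f''(z)/f'(z)$ and $\|P_f\|=\sup_{z\in\mathbb{D}}(1-|z|^2)|P_f(z)|$. *)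

(* Defs.v *)
From Stdlib Require Import Reals.
From Coquelicot Require Import Coquelicot.

Open Scope R_scope.
Open Scope C_scope.

Definition unit_disk (z : C) : Prop := (Cmod z < 1)%R.

(* Analytic on the disk: every point of the disk has a neighbourhood on which
   the function is the sum of a convergent complex power series. *)
Definition analytic_on_disk (f : C -> C) : Prop :=
  forall z : C, unit_disk z ->
    exists (a : nat -> C) (r : R), (0 < r)%R /\
      forall w : C, (Cmod (w - z) < r)%R ->
        @is_pseries C_AbsRing C_NormedModule a (w - z) (f w).

(* [C_derive] is total; it is the complex derivative wherever the function is
   complex differentiable, hence at every point of the disk when the function
   is analytic there. *)
Definition class_A (f : C -> C) : Prop :=
  analytic_on_disk f /\ f 0 = 0 /\ C_derive f 0 = 1.

Definition subordinate (g h : C -> C) : Prop :=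
  exists omega : C -> C,
    analytic_on_disk omega /\
    (forall z : C, unit_disk z -> unit_disk (omega z)) /\
    omega 0 = 0 /\
    (forall z : C, unit_disk z -> g z = h (omega z)).

(* z f'(z) / f(z), with its removable singularity at 0 filled in: the limit
   there is 1 because f(0) = 0 and f'(0) = 1. *)
Definition starlike_quotient (f : C -> C) (z : C) : C :=
  if Ceq_dec z 0 then 1 else z * C_derive f z / f z.

Definition phi_con (alpha : R) (z : C) : C :=
  3 / (3 + (alpha - 3) * z - alpha * z ^ 2).

(* No clause "f(z) <> 0 for z <> 0" is needed: for -3 < alpha <= 0 the
   denominator (1 - z) (3 + alpha z) of [phi_con] does not vanish on the disk,
   so [phi_con alpha] has no zero there, whereas f(z) = 0 would make
   [starlike_quotient f z] equal to 0. For the same reason f' has no zero in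
   the disk. *)
Definition Sstar_con (alpha : R) (f : C -> C) : Prop :=
  class_A f /\ subordinate (starlike_quotient f) (phi_con alpha).

Definition pre_schwarzian (f : C -> C) (z : C) : C :=
  C_derive (C_derive f) z / C_derive f z.

Definition pre_schwarzian_norm (f : C -> C) : Rbar :=
  Lub_Rbar (fun x : R => exists z : C, unit_disk z /\
    x = ((1 - Cmod z ^ 2) * Cmod (pre_schwarzian f z))%R).

(* Main.v *)
Require Import Defs.
From Stdlib Require Import Reals Lra Psatz Classical ClassicalEpsilon.
From Coquelicot Require Import Coquelicot.

(** Let [z f'/f = phi(omega)] with [phi(w) = 3 / ((1-w)(3+alpha w))].  Write
    [f(z) = z p(z)] and [omega(z) = z g(z)].  Then [f' = phi(omega) p], and
    [z p' = p (phi(omega) - 1)], so logarithmic differentiation gives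
[[
      f''/f' = omega' (phi'/phi)(omega) + g psi(omega),
      psi(w) = (phi(w) - 1) / w.
]]
    By partial fractions and the triangle inequality, [|phi'/phi|] and [|psi|]
    on [|w| = r] are at most their values at [w = r], because [alpha <= 0].
    Schwarz' lemma gives [|g| <= 1] and [r = |omega(z)| <= |z|], and the
    Schwarz-Pick lemma gives [(1-|z|^2) |omega'| <= 1-r^2].  Hence
    [(1-|z|^2) |f''/f'|] is at most an explicit function of
    [0 <= r < 1], which is bounded by its limit [2 (6+alpha) / (3+alpha)] at [r = 1]
    ([radial_bound]).

    The complex analysis behind this rests on pointwise second-order
    expansions ([has_jet]).  Sums of power series have them ([analytic_jets]),
    they are stable under products and inverses, and they suffice for the
    maximum modulus principle ([maximum_modulus]): averaging over the four
    points [z + i^k s] shows that [|F|^2 + eta |z|^2] has no local maximum.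
    The Schwarz-Pick lemma follows by applying the principle to a quotient of
    Moebius differences.  Since [f'] is a product of functions with known
    jets, [f''] comes without differentiating power series termwise.  The one
    delicate point is [z = 0], where [p'(0)] is found as the limit of [p'] at
    nearby points ([jet_derive_limit]). *)

Open Scope R_scope.
Open Scope C_scope.

(** * Local boundedness and second-order expansions *)

Definition near0 (P : C -> Prop) : Prop :=
  exists delta : R, (0 < delta)%R /\ forall h : C, (Cmod h < delta)%R -> P h.

Lemma near0_and (P Q : C -> Prop) :
  near0 P -> near0 Q -> near0 (fun h => P h /\ Q h).
Proof.
intros [d [hd HP]] [e [he HQ]]; exists (Rmin d e); split.
- now apply Rmin_glb_lt.
- intros h hh; split; [apply HP | apply HQ].
  + apply Rlt_le_trans with (1 := hh), Rmin_l.
  + apply Rlt_le_trans with (1 := hh), Rmin_r.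
Qed.

Lemma near0_imp (P Q : C -> Prop) :
  (forall h, P h -> Q h) -> near0 P -> near0 Q.
Proof. intros H [d [hd HP]]; exists d; auto. Qed.

Lemma near0_small (r : R) : (0 < r)%R -> near0 (fun h => (Cmod h < r)%R).
Proof. intros hr; exists r; auto. Qed.

Definition bounded_near0 (E : C -> C) : Prop :=
  exists M : R, near0 (fun h => (Cmod (E h) <= M)%R).

Lemma bounded_const (c : C) : bounded_near0 (fun _ => c).
Proof. exists (Cmod c), 1%R; split; [lra | intros; lra]. Qed.

Lemma bounded_id : bounded_near0 (fun h => h).
Proof. exists 1%R, 1%R; split; [lra | intros; lra]. Qed.

Lemma bounded_plus (E E' : C -> C) :
  bounded_near0 E -> bounded_near0 E' -> bounded_near0 (fun h => E h + E' h).
Proof.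
intros [M HM] [N HN]; exists (M + N)%R.
apply near0_imp with (2 := near0_and _ _ HM HN); intros h [H1 H2].
apply Rle_trans with (1 := Cmod_triangle _ _); lra.
Qed.

Lemma bounded_mult (E E' : C -> C) :
  bounded_near0 E -> bounded_near0 E' -> bounded_near0 (fun h => E h * E' h).
Proof.
intros [M HM] [N HN]; exists (M * N)%R.
apply near0_imp with (2 := near0_and _ _ HM HN); intros h [H1 H2].
rewrite Cmod_mult; apply Rmult_le_compat; auto using Cmod_ge_0.
Qed.

Lemma bounded_opp (E : C -> C) :
  bounded_near0 E -> bounded_near0 (fun h => - E h).
Proof.
intros [M HM]; exists M; apply near0_imp with (2 := HM).
intros h; now rewrite Cmod_opp.
Qed.

(** The only form in which the Landau relation [h * O(1) = o(1)] is used. *)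
Lemma near0_mult_small (E : C -> C) (eps : R) :
  bounded_near0 E -> (0 < eps)%R -> near0 (fun h => (Cmod (h * E h) < eps)%R).
Proof.
intros [M HM] heps.
assert (hM : (0 <= Rabs M)%R) by apply Rabs_pos.
assert (he : (0 < eps / (Rabs M + 1))%R) by (apply Rdiv_lt_0_compat; lra).
apply near0_imp with (2 := near0_and _ _ HM (near0_small _ he)).
intros h [H1 H2]; rewrite Cmod_mult.
assert (H3 : (Cmod (E h) <= Rabs M)%R).
{ apply Rle_trans with (1 := H1), Rle_abs. }
assert (H4 : (eps / (Rabs M + 1) * (Rabs M + 1) = eps)%R) by (field; lra).
assert (H5 := Cmod_ge_0 h); assert (H6 := Cmod_ge_0 (E h)).
nra.
Qed.

Lemma bounded_inv (c : C) (E : C -> C) :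
  c <> 0 -> bounded_near0 E -> bounded_near0 (fun h => / (c + h * E h)).
Proof.
intros hc hR.
assert (hm : (0 < Cmod c)%R) by now apply Cmod_gt_0.
exists (/ (Cmod c / 2))%R.
assert (H := near0_mult_small E (Cmod c / 2) hR ltac:(lra)).
apply near0_imp with (2 := H); intros h hh.
assert (H1 : (Cmod c <= Cmod (c + h * E h) + Cmod (h * E h))%R).
{ replace c with ((c + h * E h) + - (h * E h)) at 1 by ring.
  apply Rle_trans with (1 := Cmod_triangle _ _); rewrite Cmod_opp; lra. }
rewrite Cmod_inv.
- apply Rinv_le_contravar; lra.
- apply Cmod_gt_0; lra.
Qed.

Ltac bounded :=
  repeat first [ assumption | apply bounded_const | apply bounded_id
               | apply bounded_plus | apply bounded_opp | apply bounded_mult ].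

(** A complex Taylor expansion of [F] at the single point [z], with derivative
    [d] and an error [O(h^3)].  Order two is what the maximum principle
    consumes: it needs the error to be negligible against [|h|^2].  Unlike
    local power series, pointwise expansions pass to products and inverses by
    plain algebra, without Cauchy products or rearrangements. *)
Definition has_jet (F : C -> C) (z d : C) : Prop :=
  exists (c : C) (E : C -> C), bounded_near0 E /\
    near0 (fun h => F (z + h) = F z + d * h + c * h ^ 2 + h ^ 3 * E h).

Lemma jet_ext_loc (F G : C -> C) (z d : C) :
  near0 (fun h => F (z + h) = G (z + h)) -> has_jet F z d -> has_jet G z d.
Proof.
intros H [c [E [HE HF]]]; exists c, E; split; trivial.
assert (H0 : F z = G z).
{ destruct H as [e [he H]]; specialize (H 0); rewrite Cplus_0_r in H.
  apply H; rewrite Cmod_0; lra. }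
apply near0_imp with (2 := near0_and _ _ H HF); intros h [H1 H2].
now rewrite <- H1, <- H0.
Qed.

Lemma jet_eq (F : C -> C) (z d e : C) :
  has_jet F z d -> d = e -> has_jet F z e.
Proof. now intros H <-. Qed.

Lemma jet_const (c z : C) : has_jet (fun _ => c) z 0.
Proof.
exists 0, (fun _ => 0); split; [bounded |].
exists 1%R; split; [lra | intros; ring].
Qed.

Lemma jet_id (z : C) : has_jet (fun w => w) z 1.
Proof.
exists 0, (fun _ => 0); split; [bounded |].
exists 1%R; split; [lra | intros; ring].
Qed.

Lemma jet_plus (F G : C -> C) (z d e : C) :
  has_jet F z d -> has_jet G z e -> has_jet (fun w => F w + G w) z (d + e).
Proof.
intros [c [E [HE HF]]] [c' [E' [HE' HG]]].
exists (c + c'), (fun h => E h + E' h); split; [bounded |].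
apply near0_imp with (2 := near0_and _ _ HF HG); intros h [H1 H2].
rewrite H1, H2; ring.
Qed.

Lemma jet_mult (F G : C -> C) (z d e : C) :
  has_jet F z d -> has_jet G z e ->
  has_jet (fun w => F w * G w) z (d * G z + F z * e).
Proof.
intros [c [E [HE HF]]] [c' [E' [HE' HG]]].
exists (F z * c' + d * e + c * G z),
  (fun h => (F z + d * h + c * h ^ 2) * E' h + E h * (G z + e * h + c' * h ^ 2)
            + (d * c' + c * e) + c * c' * h + h ^ 3 * (E h * E' h)).
split.
- unfold Cpow; bounded.
- apply near0_imp with (2 := near0_and _ _ HF HG); intros h [H1 H2].
  rewrite H1, H2; ring.
Qed.

Lemma jet_inv (F : C -> C) (z d : C) :
  has_jet F z d -> F z <> 0 -> has_jet (fun w => / F w) z (- d / F z ^ 2).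
Proof.
intros [c [E [HE HF]]] hF.
set (a := F z) in *.
set (e := (d ^ 2 - a * c) / a ^ 3).
set (T := fun h => d + c * h + h ^ 2 * E h).
assert (hT : bounded_near0 T) by (unfold T, Cpow; bounded).
assert (hI := bounded_inv a T hF hT).
assert (hnz : near0 (fun h => a + h * T h <> 0)).
{ assert (hm : (0 < Cmod a)%R) by now apply Cmod_gt_0.
  apply near0_imp with (2 := near0_mult_small T _ hT hm); intros h hh h0.
  replace a with (- (h * T h)) in hh; [rewrite Cmod_opp in hh; lra |].
  replace a with ((a + h * T h) + - (h * T h)) by ring; rewrite h0; ring. }
(* If [q] is the quadratic polynomial inverse to [F] modulo [h^3], then
   [F q = 1 + h^3 X], so [1/F = q - h^3 X / F]; [- X] is the last factor. *)
exists e, (fun h => / (a + h * T h) *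
  (- (E h * (/ a - d / a ^ 2 * h + e * h ^ 2) - c * d / a ^ 2 + d * e
      + c * e * h))).
split.
- unfold Cpow, Cdiv, Cminus; bounded.
- apply near0_imp with (2 := near0_and _ _ HF hnz); intros h [H1 H2].
  rewrite H1.
  replace (a + d * h + c * h ^ 2 + h ^ 3 * E h) with (a + h * T h)
    by (unfold T; ring).
  change (F z) with a; unfold e, T in *; field; split; trivial.
Qed.

(** * Power series and difference quotients *)

Definition sums_on (a : nat -> C) (r : R) (f : C -> C) : Prop :=
  forall h : C, (Cmod h < r)%R ->
    @is_pseries C_AbsRing C_NormedModule a h (f h).

Lemma norm_pow_n (h : C) (n : nat) :
  @eq R (Cmod (@pow_n C_AbsRing h n)) (Cmod h ^ n)%R.
Proof.
induction n as [|n IH]; simpl.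
- exact Cmod_1.
- rewrite <- IH; exact (Cmod_mult _ _).
Qed.

(** Convergence at a point of modulus [r/2] bounds the terms [a_n (r/2)^n] by
    [2M]; for [|h| < r/4] the series is then dominated by the geometric series
    [2M sum 2^(-n)].  The remainders in a jet are controlled this way. *)
Lemma sums_on_bounded (a : nat -> C) (r : R) (f : C -> C) :
  (0 < r)%R -> sums_on a r f -> bounded_near0 f.
Proof.
intros hr H.
pose (h0 := RtoC (r / 2)).
assert (hh0 : Cmod h0 = (r / 2)%R).
{ unfold h0; rewrite Cmod_R; apply Rabs_pos_eq; lra. }
assert (H0 := H h0 ltac:(rewrite hh0; lra)).
destruct (filterlim_bounded _ (ex_intro _ _ H0)) as [M HM].
assert (hM : (0 <= M)%R) by (apply Rle_trans with (2 := HM O), norm_ge_0).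
assert (ht : forall n, ((r / 2) ^ n * Cmod (a n) <= 2 * M)%R).
{ intros n.
  replace ((r / 2) ^ n * Cmod (a n))%R
    with (@norm C_AbsRing C_NormedModule
            (scal (pow_n (K := C_AbsRing) h0 n) (a n))).
  2:{ rewrite <- hh0, <- norm_pow_n; exact (Cmod_mult _ _). }
  destruct n as [|n].
  - generalize (HM O); rewrite sum_O; intros hM0.
    apply Rle_trans with (1 := hM0); lra.
  - assert (HS := HM (S n)); assert (HN := HM n).
    rewrite sum_Sn in HS.
    set (s := sum_n _ _) in *; set (t := scal _ _) in *.
    replace t with (minus (plus s t) s).
    + apply Rle_trans with (1 := norm_triangle _ _); rewrite norm_opp; lra.
    + change (s + t - s = t); ring. }
exists (4 * M)%R, (r / 4)%R; split; [lra |]; intros h hh.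
assert (Hh := H h ltac:(lra)).
pose (term := fun n =>
  @scal C_AbsRing C_NormedModule (pow_n (K := C_AbsRing) h n) (a n)).
(* The exact partial sum of the geometric bound makes the induction close. *)
assert (hp : forall n, (norm (sum_n term n) <= 4 * M - 2 * M * (1 / 2) ^ n)%R).
{ assert (hterm : forall n, (norm (term n) <= 2 * M * (1 / 2) ^ n)%R).
  { intros n.
    replace (norm (term n)) with (Cmod h ^ n * Cmod (a n))%R.
    2:{ rewrite <- norm_pow_n; symmetry; exact (Cmod_mult _ _). }
    apply Rle_trans with ((r / 2 * (1 / 2)) ^ n * Cmod (a n))%R.
    - apply Rmult_le_compat_r; [apply Cmod_ge_0 |].
      apply pow_incr; split; [apply Cmod_ge_0 | lra].
    - rewrite Rpow_mult_distr.
      assert (0 <= (1 / 2) ^ n)%R by (apply pow_le; lra).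
      specialize (ht n); nra. }
  induction n as [|n IH].
  - rewrite sum_O; generalize (hterm O); simpl; lra.
  - rewrite sum_Sn; apply Rle_trans with (1 := norm_triangle _ _).
    generalize (hterm (S n)); simpl; lra. }
assert (hl : is_lim_seq (fun n => norm (sum_n term n)) (Cmod (f h))).
{ apply (filterlim_comp _ _ _ _ _ _ _ _ Hh).
  exact (@filterlim_norm C_AbsRing C_NormedModule (f h)). }
apply (is_lim_seq_le _ (fun _ => 4 * M)%R (Cmod (f h)) (4 * M)%R) with (2 := hl).
- intros n; apply Rle_trans with (1 := hp n).
  assert (0 <= (1 / 2) ^ n)%R by (apply pow_le; lra); nra.
- apply is_lim_seq_const.
Qed.

Lemma sums_on_0 (a : nat -> C) (r : R) (f : C -> C) :
  (0 < r)%R -> sums_on a r f -> f 0 = a O.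
Proof.
intros hr H.
apply (@filterlim_locally_unique nat C_AbsRing C_NormedModule eventually _ _ _ _
  (H 0 ltac:(rewrite Cmod_0; lra))).
exact (@is_pseries_0 C_AbsRing C_NormedModule a).
Qed.

Lemma sums_on_tail (a : nat -> C) (r : R) (f : C -> C) :
  (0 < r)%R -> sums_on a r f ->
  exists f1 : C -> C, sums_on (fun n => a (S n)) r f1 /\
    forall h, (Cmod h < r)%R -> f h = a O + h * f1 h.
Proof.
intros hr H.
exists (fun h => if Ceq_dec h 0 then a 1%nat else / h * (f h - a O)); split.
- intros h hh; destruct (Ceq_dec h 0) as [-> | hz].
  + exact (@is_pseries_0 C_AbsRing C_NormedModule (fun n => a (S n))).
  + apply (@is_pseries_decr_1 C_AbsRing C_NormedModule a h (/ h) (f h)); auto.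
    exact (Cinv_l _ hz).
- intros h hh; destruct (Ceq_dec h 0) as [-> | hz].
  + rewrite (sums_on_0 a r f hr H); ring.
  + field; trivial.
Qed.

Lemma jet_C_derive (F : C -> C) (z d : C) :
  has_jet F z d -> C_derive F z = d.
Proof.
intros [c [E [HE HF]]].
apply is_C_lim_unique.
apply (proj2 (@filterlim_locally C C_UniformSpace (locally' z) _ _ d)); intros eps.
pose (T := fun h => c + h * E h).
assert (hT : bounded_near0 T) by (unfold T; bounded).
destruct (near0_and _ _ HF (near0_mult_small T eps hT (cond_pos eps)))
  as [delta [hd H]].
assert (hd2 : (0 < delta / 2)%R) by lra.
exists (mkposreal _ hd2); refine (fun (y : C) hy hyz => _).
apply C_NormedModule_mixin_compat1.
assert (hm : (Cmod (y - z) < delta)%R).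
{ apply Rle_lt_trans with (1 := Cmod_2Rmax _).
  destruct hy as [hy1 hy2]; unfold ball in hy1, hy2; simpl in hy1, hy2.
  unfold AbsRing_ball, abs, minus, plus, opp in hy1, hy2; simpl in hy1, hy2.
  assert (hs : (sqrt 2 < 2)%R).
  { rewrite <- (sqrt_Rsqr 2) at 2 by lra; unfold Rsqr; apply sqrt_lt_1; lra. }
  assert (hs0 : (0 < sqrt 2)%R) by (apply sqrt_lt_R0; lra).
  assert (hx :
    (Rmax (Rabs (fst (y - z)%C)) (Rabs (snd (y - z)%C)) < delta / 2)%R)
    by (apply Rmax_lub_lt; assumption).
  assert (hx0 : (0 <= Rmax (Rabs (fst (y - z)%C)) (Rabs (snd (y - z)%C)))%R)
    by (apply Rle_trans with (2 := Rmax_l _ _), Rabs_pos).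
  nra. }
destruct (H _ hm) as [H1 H2].
replace (z + (y - z)) with y in H1 by ring.
assert (hn : y - z <> 0).
{ intros h0; apply hyz; replace y with (z + (y - z)) by ring; rewrite h0.
  change (z + 0 = z); ring. }
replace (minus ((F y - F z) / (y - z)) d) with ((y - z) * T (y - z)); trivial.
change (minus ((F y - F z) / (y - z)) d) with ((F y - F z) / (y - z) - d).
rewrite H1; unfold T; field; trivial.
Qed.

Lemma jet_self (F : C -> C) (z d : C) :
  has_jet F z d -> has_jet F z (C_derive F z).
Proof. intros H; now rewrite (jet_C_derive _ _ _ H). Qed.

(** The difference quotient with its removable singularity filled in: this is
    [f(z)/z] for [f] in the class A, and the quotient in Schwarz' lemma. *)
Definition slope (F : C -> C) (z0 z : C) : C :=
  if Ceq_dec z z0 then C_derive F z0 else (F z - F z0) / (z - z0).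

Lemma slope_spec (F : C -> C) (z0 z : C) : F z = F z0 + (z - z0) * slope F z0 z.
Proof.
unfold slope; destruct (Ceq_dec z z0) as [-> | hz]; [ring |].
field; intros h0; apply hz; replace z with (z0 + (z - z0)) by ring.
rewrite h0; ring.
Qed.

Lemma slope_at (F : C -> C) (z0 : C) : slope F z0 z0 = C_derive F z0.
Proof. unfold slope; destruct (Ceq_dec z0 z0); tauto. Qed.

(** Splitting off the coefficients [a_0, ..., a_3] one at a time gives a jet of
    [f] and, one index further, a jet of the difference quotient at its own
    singular point, the only place where that is not a matter of algebra. *)
Lemma analytic_jets (f : C -> C) (z : C) :
  analytic_on_disk f -> unit_disk z ->
  has_jet f z (C_derive f z) /\
  has_jet (slope f z) z (C_derive (slope f z) z).
Proof.
intros Hf hz; destruct (Hf z hz) as [a [r [hr H]]].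
assert (H0 : sums_on a r (fun h => f (z + h))).
{ intros h hh; replace h with (z + h - z) at 1 by ring.
  apply H; now replace (z + h - z) with h by ring. }
destruct (sums_on_tail _ _ _ hr H0) as [f1 [H1 E1]].
destruct (sums_on_tail _ _ _ hr H1) as [f2 [H2 E2]].
destruct (sums_on_tail _ _ _ hr H2) as [f3 [H3 E3]].
destruct (sums_on_tail _ _ _ hr H3) as [f4 [H4 E4]].
assert (Ez : f z = a O).
{ rewrite <- (sums_on_0 _ _ _ hr H0); f_equal; ring. }
assert (J : has_jet f z (a 1%nat)).
{ exists (a 2%nat), f3; split; [exact (sums_on_bounded _ _ _ hr H3) |].
  apply near0_imp with (2 := near0_small r hr); intros h hh.
  rewrite (E1 h hh), (E2 h hh), (E3 h hh), Ez; ring. }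
assert (D := jet_C_derive _ _ _ J).
split; [now rewrite D |].
apply (jet_self _ _ (a 2%nat)).
exists (a 3%nat), f4; split; [exact (sums_on_bounded _ _ _ hr H4) |].
apply near0_imp with (2 := near0_small r hr); intros h hh.
rewrite slope_at, D; unfold slope; destruct (Ceq_dec (z + h) z) as [e | hn].
- assert (h0 : h = 0) by (replace h with (z + h - z) by ring; rewrite e; ring).
  rewrite h0, D; ring.
- rewrite (E1 h hh), Ez, (E2 h hh), (E3 h hh), (E4 h hh); field.
  intros h0; apply hn; rewrite <- (Cplus_0_r z) at 2; f_equal.
  rewrite <- h0; ring.
Qed.

(** * The maximum modulus principle *)

Lemma Cmod_le_sum (z : C) : (Cmod z <= Rabs (fst z) + Rabs (snd z))%R.
Proof.
destruct z as [x y].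
replace (Cmod (x, y)) with (Cmod (RtoC x + Ci * RtoC y)).
- apply Rle_trans with (1 := Cmod_triangle _ _).
  rewrite Cmod_mult, Cmod_Ci, !Cmod_R; simpl; lra.
- f_equal; apply injective_projections; simpl; ring.
Qed.

(** Heine-Borel in the form needed for extrema: a constant that works locally
    and may be decreased can be chosen once for the whole disk. *)
Lemma uniform_of_local (P : R -> C -> Prop) (rho : R) :
  (forall d d' w, (0 < d' <= d)%R -> P d w -> P d' w) ->
  (forall z, exists d : R, (0 < d)%R /\ near0 (fun h => P d (z + h))) ->
  exists d : R, (0 < d)%R /\ forall w, (Cmod w <= rho)%R -> P d w.
Proof.
intros Hmono Hloc.
assert (Hd : forall z, exists d : posreal,
  forall h, (Cmod h < 2 * d)%R -> P d (z + h)).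
{ intros z; destruct (Hloc z) as [d [hd [e [he H]]]].
  assert (hm : (0 < Rmin d (e / 2))%R) by (apply Rmin_glb_lt; lra).
  exists (mkposreal _ hm); simpl; intros h hh.
  apply Hmono with d.
  - split; [trivial | apply Rmin_l].
  - apply H; generalize (Rmin_r d (e / 2)); lra. }
destruct (choice _ Hd) as [delta Hdelta].
destruct (compactness_value_2d (- rho) rho (- rho) rho (fun x y => delta (x, y)))
  as [d Hc].
exists d; split; [apply cond_pos |]; intros [x y] hw.
assert (hm := Rmax_Cmod (x, y)); simpl in hm.
assert (hx : (Rabs x <= rho)%R).
{ apply Rle_trans with (2 := hw), Rle_trans with (2 := hm), Rmax_l. }
assert (hy : (Rabs y <= rho)%R).
{ apply Rle_trans with (2 := hw), Rle_trans with (2 := hm), Rmax_r. }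
apply Rabs_le_between in hx; apply Rabs_le_between in hy.
destruct (NNPP _ (Hc x y hx hy)) as [u [v [_ [_ [h1 [h2 h3]]]]]].
apply Hmono with (delta (u, v)).
- split; [apply cond_pos | trivial].
- replace (x, y) with ((u, v) + (x - u, y - v)%R).
  + apply Hdelta; apply Rle_lt_trans with (1 := Cmod_le_sum _); simpl.
    apply Rlt_le_trans with (delta (u, v) + delta (u, v))%R; [| lra].
    now apply Rplus_lt_compat.
  + apply injective_projections; simpl; ring.
Qed.

(** Both halves of the extreme value theorem are instances of
    [uniform_of_local]: for boundedness with the local bound [u <= 1/d], for
    attainment with [u <= S - d], where [S] is the supremum: if [S] were not
    attained, the uniform version would push the supremum below [S]. *)
Lemma max_on_closed_disk (u : C -> R) (rho : R) :
  (0 <= rho)%R ->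
  (forall z, (Cmod z <= rho)%R -> forall eps : R, (0 < eps)%R ->
    near0 (fun h => (Rabs (u (z + h)%C - u z) < eps)%R)) ->
  exists z0, (Cmod z0 <= rho)%R /\
    forall z, (Cmod z <= rho)%R -> (u z <= u z0)%R.
Proof.
intros hrho Hu.
assert (Hout : forall z, (rho < Cmod z)%R ->
  near0 (fun h => ~ (Cmod (z + h) <= rho)%R)).
{ intros z hz; exists (Cmod z - rho)%R; split; [lra |]; intros h hh hzh.
  assert (H : (Cmod z <= Cmod (z + h) + Cmod h)%R).
  { rewrite <- (Cmod_opp h); replace z with (z + h + - h) at 1 by ring.
    apply Cmod_triangle. }
  lra. }
assert (Hglob : forall P : R -> C -> Prop,
  (forall d d' w, (0 < d' <= d)%R -> P d w -> P d' w) ->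
  (forall z, (Cmod z <= rho)%R ->
    exists d : R, (0 < d)%R /\ near0 (fun h => P d (z + h))) ->
  exists d : R, (0 < d)%R /\ forall w, (Cmod w <= rho)%R -> P d w).
{ intros P Pmono Ploc.
  destruct (uniform_of_local (fun d w => (Cmod w <= rho)%R -> P d w) rho)
    as [d [hd H]].
  - intros d d' w hd H hw; apply Pmono with (1 := hd); auto.
  - intros z; destruct (Rle_lt_dec (Cmod z) rho) as [hz | hz].
    + destruct (Ploc z hz) as [d [hd H]]; exists d; split; trivial.
      apply near0_imp with (2 := H); auto.
    + exists 1%R; split; [lra |].
      apply near0_imp with (2 := Hout z hz); tauto.
  - exists d; auto. }
destruct (Hglob (fun d w => d * u w <= 1)%R) as [d [hd Hb]].
{ intros d d' w hd H; destruct (Rle_lt_dec (u w) 0); nra. }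
{ intros z hz; exists (/ (Rabs (u z) + 1))%R.
  assert (hp : (0 < Rabs (u z) + 1)%R) by (generalize (Rabs_pos (u z)); lra).
  split; [now apply Rinv_0_lt_compat |].
  apply near0_imp with (2 := Hu z hz 1%R Rlt_0_1); intros h hh.
  apply Rabs_def2 in hh; generalize (Rle_abs (u z)); intros ha.
  apply (Rmult_le_reg_l (Rabs (u z) + 1)); trivial.
  rewrite <- Rmult_assoc, Rinv_r by lra; lra. }
destruct (completeness (fun y => exists z, (Cmod z <= rho)%R /\ y = u z))
  as [S [HS1 HS2]].
{ exists (/ d)%R; intros y [z [hz ->]].
  apply (Rmult_le_reg_l d); trivial; rewrite Rinv_r by lra; auto. }
{ exists (u 0), 0; split; trivial; rewrite Cmod_0; trivial. }
apply NNPP; intros Hno.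
assert (Hlt : forall z, (Cmod z <= rho)%R -> (u z < S)%R).
{ intros z hz; destruct (Rle_lt_dec S (u z)) as [h | h]; trivial.
  case Hno; exists z; split; trivial; intros w hw.
  apply Rle_trans with (2 := h), HS1; now exists w. }
destruct (Hglob (fun d w => u w <= S - d)%R) as [e [he Hs]].
{ intros; lra. }
{ intros z hz; assert (H := Hlt z hz); exists ((S - u z) / 2)%R.
  split; [lra |].
  apply near0_imp with (2 := Hu z hz ((S - u z) / 2)%R ltac:(lra)).
  intros h hh; apply Rabs_def2 in hh; lra. }
assert (S <= S - e)%R; [| lra].
apply HS2; intros y [z [hz ->]]; auto.
Qed.

Lemma jet_continuous (F : C -> C) (z d : C) (eps : R) :
  has_jet F z d -> (0 < eps)%R ->
  near0 (fun h => (Cmod (F (z + h)%C - F z) < eps)%R).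
Proof.
intros [c [E [HE HF]]] heps.
assert (hT : bounded_near0 (fun h => d + c * h + h ^ 2 * E h))
  by (unfold Cpow; bounded).
apply near0_imp with (2 := near0_and _ _ HF (near0_mult_small _ eps hT heps)).
intros h [H1 H2]; rewrite H1.
replace (_ - _) with (h * (d + c * h + h ^ 2 * E h)) by ring; trivial.
Qed.

Lemma Cmod_sqr_diff (a b : C) :
  (Rabs (Cmod a ^ 2 - Cmod b ^ 2) <= Cmod (a - b) * (Cmod (a - b) + 2 * Cmod b))%R.
Proof.
assert (H1 : (Cmod a <= Cmod (a - b) + Cmod b)%R).
{ replace a with ((a - b) + b) at 1 by ring; apply Cmod_triangle. }
assert (H2 : (Cmod b <= Cmod (a - b) + Cmod a)%R).
{ replace b with (- (a - b) + a) at 1 by ring.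
  rewrite <- (Cmod_opp (a - b)); apply Cmod_triangle. }
assert (h1 := Cmod_ge_0 a); assert (h2 := Cmod_ge_0 b).
assert (h3 := Cmod_ge_0 (a - b)).
apply Rabs_le; split; nra.
Qed.

Lemma jet_sqr_continuous (F : C -> C) (z d : C) (eps : R) :
  has_jet F z d -> (0 < eps)%R ->
  near0 (fun h => (Rabs (Cmod (F (z + h)%C) ^ 2 - Cmod (F z) ^ 2) < eps)%R).
Proof.
intros HF heps.
assert (hb := Cmod_ge_0 (F z)).
set (K := (1 + 2 * Cmod (F z))%R).
assert (hK : (0 < K)%R) by (unfold K; lra).
assert (he : (0 < Rmin 1 (eps / K))%R).
{ apply Rmin_glb_lt; [lra | now apply Rdiv_lt_0_compat]. }
apply near0_imp with (2 := jet_continuous F z d _ HF he); intros h hh.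
apply Rle_lt_trans with (1 := Cmod_sqr_diff _ _).
assert (h1 := Rmin_l 1 (eps / K)); assert (h2 := Rmin_r 1 (eps / K)).
assert (h3 := Cmod_ge_0 (F (z + h)%C - F z)).
assert (h4 : (eps / K * K = eps)%R) by (field; lra).
fold K in h4; unfold K in *; nra.
Qed.

(** Averaging over the square [s, is, -s, -is] kills all cross terms of
    [|a + d h + c h^2|^2], because [h], [h^2] and [h conj(h)^2] sum to zero
    there.  This replaces the mean value property over circles. *)
Lemma four_point_mean (a d c : C) (s : R) :
  let A := fun h : C => a + d * h + c * h ^ 2 in
  (Cmod (A s) ^ 2 + Cmod (A (- s)%C) ^ 2
   + Cmod (A (Ci * s)%C) ^ 2 + Cmod (A (- (Ci * s))%C) ^ 2
   = 4 * (Cmod a ^ 2 + Cmod d ^ 2 * s ^ 2 + Cmod c ^ 2 * s ^ 4))%R.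
Proof.
intros A; unfold A; rewrite !Cmod2_alt.
destruct a as [a1 a2], d as [d1 d2], c as [c1 c2].
unfold Re, Im; simpl; ring.
Qed.

(** At [z + h] with [h] on the four-point square of size [s], the function
    [|F|^2 + eta |z|^2] exceeds its value at [z] on average by at least
    [eta s^2 - O(s^3)], so no local maximum is possible.  The term in [eta]
    makes subharmonicity strict and dispenses with the case distinction on
    the order of vanishing of [F - F z]. *)
Lemma no_interior_max (F : C -> C) (z d : C) (eta : R) :
  has_jet F z d -> (0 < eta)%R ->
  ~ near0 (fun h => (Cmod (F (z + h)%C) ^ 2 + eta * Cmod (z + h) ^ 2
                     <= Cmod (F z) ^ 2 + eta * Cmod z ^ 2)%R).
Proof.
intros [c [E [[M HE] HF]]] heta Hmax.
destruct (near0_and _ _ Hmax (near0_and _ _ HE HF)) as [delta [hdelta H]].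
set (K := (Cmod (F z) + Cmod d + Cmod c)%R).
assert (hK : (0 <= K)%R).
{ unfold K; generalize (Cmod_ge_0 (F z)) (Cmod_ge_0 d) (Cmod_ge_0 c); lra. }
assert (hM : (0 <= M)%R).
{ destruct (H 0) as [_ [h _]]; [rewrite Cmod_0; lra |].
  apply Rle_trans with (2 := h), Cmod_ge_0. }
(* The last bound gives [2 K M s^3 < eta s^2]: the error made in [|F|^2] by
   dropping the remainder, at most [2 K M s^3], is beaten by [eta s^2]. *)
set (s := Rmin (Rmin 1 (delta / 2)) (eta / (2 * K * M + 1))).
assert (hKM : (0 < 2 * K * M + 1)%R) by nra.
assert (hs : (0 < s)%R).
{ unfold s; repeat apply Rmin_glb_lt; try lra; now apply Rdiv_lt_0_compat. }
assert (hs1 : (s <= 1)%R).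
{ unfold s; apply Rle_trans with (1 := Rmin_l _ _), Rmin_l. }
assert (hs2 : (s < delta)%R).
{ apply Rle_lt_trans with (delta / 2)%R; [| lra].
  unfold s; apply Rle_trans with (1 := Rmin_l _ _), Rmin_r. }
assert (hs3 : (2 * K * M * s < eta)%R).
{ assert (s <= eta / (2 * K * M + 1))%R by apply Rmin_r.
  assert (eta / (2 * K * M + 1) * (2 * K * M + 1) = eta)%R by (field; lra).
  nra. }
clearbody s.
set (A := fun h : C => F z + d * h + c * h ^ 2).
assert (key : forall h, Cmod h = s ->
  (Cmod (A h) ^ 2 - 2 * K * (M * s ^ 3) + eta * Cmod (z + h) ^ 2
   <= Cmod (F z) ^ 2 + eta * Cmod z ^ 2)%R).
{ intros h hh; destruct (H h) as [H1 [H2 H3]]; [lra |].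
  apply Rle_trans with (2 := H1); apply Rplus_le_compat_r.
  assert (hA : (Cmod (A h) <= K)%R).
  { unfold A, K.
    apply Rle_trans with (1 := Cmod_triangle _ _); apply Rplus_le_compat.
    - apply Rle_trans with (1 := Cmod_triangle _ _), Rplus_le_compat_l.
      rewrite Cmod_mult, hh; generalize (Cmod_ge_0 d); nra.
    - rewrite Cmod_mult, Cmod_pow, hh; generalize (Cmod_ge_0 c).
      assert (s ^ 2 <= 1)%R by nra; nra. }
  assert (hB : (Cmod (h ^ 3 * E h) <= M * s ^ 3)%R).
  { rewrite Cmod_mult, Cmod_pow, hh, (Rmult_comm M).
    apply Rmult_le_compat_l; trivial; apply pow_le; lra. }
  assert (hT : (Cmod (A h) <= Cmod (F (z + h)%C) + Cmod (h ^ 3 * E h))%R).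
  { rewrite <- (Cmod_opp (h ^ 3 * E h)), H3.
    replace (A h) with (F z + d * h + c * h ^ 2 + h ^ 3 * E h + - (h ^ 3 * E h))
      by (unfold A; ring).
    apply Cmod_triangle. }
  assert (h1 := Cmod_ge_0 (A h)); assert (h2 := Cmod_ge_0 (F (z + h)%C)).
  assert (h3 := Cmod_ge_0 (h ^ 3 * E h)).
  set (x := Cmod (A h)) in *; set (y := Cmod (F (z + h)%C)) in *.
  set (b := Cmod (h ^ 3 * E h)) in *; set (m := (M * s ^ 3)%R) in *.
  assert (hm : (x * m <= K * m)%R) by (apply Rmult_le_compat_r; lra).
  destruct (Rle_lt_dec x m); nra. }
assert (hsr : Cmod s = s) by (rewrite Cmod_R; apply Rabs_pos_eq; lra).
assert (hi : Cmod (Ci * s) = s) by (rewrite Cmod_mult, Cmod_Ci, hsr; ring).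
assert (k1 := key s hsr).
assert (k2 := key (- s) ltac:(rewrite Cmod_opp; exact hsr)).
assert (k3 := key (Ci * s) hi).
assert (k4 := key (- (Ci * s)) ltac:(rewrite Cmod_opp; exact hi)).
assert (mF := four_point_mean (F z) d c s); cbv zeta in mF.
assert (mz := four_point_mean z 1 0 s); cbv beta zeta in mz.
assert (hz : forall h, z + 1 * h + 0 * h ^ 2 = z + h) by (intros; ring).
change (fun h : C => F z + d * h + c * h ^ 2) with A in mF.
rewrite !hz, Cmod_1, Cmod_0 in mz.
assert (hd := pow2_ge_0 (Cmod d)); assert (hc := pow2_ge_0 (Cmod c)).
assert (p1 : (0 <= Cmod d ^ 2 * s ^ 2)%R) by nra.
assert (p2 : (0 <= Cmod c ^ 2 * s ^ 4)%R).
{ assert (0 <= s ^ 4)%R by (apply pow_le; lra); nra. }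
assert (p3 : (2 * K * (M * s ^ 3) < eta * s ^ 2)%R).
{ replace (2 * K * (M * s ^ 3))%R with (2 * K * M * s * s ^ 2)%R by ring.
  apply Rmult_lt_compat_r; [apply pow_lt |]; trivial. }
nra.
Qed.

(** The maximum of [|F|^2 + eta |z|^2] over the closed disk lies on the
    boundary circle, where it is at most [m + eta rho^2]; let [eta] tend
    to 0. *)
Lemma maximum_modulus (F : C -> C) (rho m : R) :
  (0 <= rho)%R ->
  (forall z, (Cmod z <= rho)%R -> exists d, has_jet F z d) ->
  (forall z, Cmod z = rho -> (Cmod (F z) ^ 2 <= m)%R) ->
  forall z, (Cmod z <= rho)%R -> (Cmod (F z) ^ 2 <= m)%R.
Proof.
intros hrho HF Hm z hz.
apply le_epsilon; intros eps heps.
set (eta := (eps / (rho ^ 2 + 1))%R).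
assert (hr2 : (0 <= rho ^ 2)%R) by apply pow2_ge_0.
assert (heta : (0 < eta)%R) by (apply Rdiv_lt_0_compat; lra).
assert (he : (eta * (rho ^ 2 + 1) = eps)%R) by (unfold eta; field; lra).
set (u := fun w => (Cmod (F w) ^ 2 + eta * Cmod w ^ 2)%R).
destruct (max_on_closed_disk u rho hrho) as [z0 [hz0 Hz0]].
{ intros w hw e hepos; destruct (HF w hw) as [d Hd].
  assert (he2 : (0 < e / 2)%R) by lra.
  assert (he3 : (0 < e / 2 / eta)%R) by (apply Rdiv_lt_0_compat; lra).
  apply near0_imp with (2 := near0_and _ _
    (jet_sqr_continuous F w d _ Hd he2)
    (jet_sqr_continuous (fun x => x) w 1 _ (jet_id w) he3)).
  intros h [H1 H2]; unfold u.
  assert (H3 : (e / 2 / eta * eta = e / 2)%R) by (field; lra).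
  apply Rabs_def2 in H1; apply Rabs_def2 in H2; apply Rabs_def1; nra. }
assert (Hb : Cmod z0 = rho).
{ destruct (Rle_lt_or_eq_dec _ _ hz0) as [hlt | ]; trivial; exfalso.
  destruct (HF z0 hz0) as [d Hd].
  apply (no_interior_max F z0 d eta Hd heta).
  apply near0_imp with (2 := near0_small (rho - Cmod z0) ltac:(lra)).
  intros h hh; apply Hz0.
  apply Rle_trans with (1 := Cmod_triangle _ _); lra. }
assert (H1 := Hz0 z hz); assert (H2 := Hm z0 Hb); unfold u in H1.
rewrite Hb in H1.
assert (H3 : (0 <= eta * Cmod z ^ 2)%R)
  by (apply Rmult_le_pos; [lra | apply pow2_ge_0]).
nra.
Qed.

(** * The Schwarz-Pick lemma *)

Lemma disk_near (z : C) : unit_disk z -> near0 (fun h => unit_disk (z + h)).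
Proof.
intros hz; unfold unit_disk in *; exists (1 - Cmod z)%R; split; [lra |].
intros h hh; apply Rle_lt_trans with (1 := Cmod_triangle _ _); lra.
Qed.

Lemma near0_apart (z z0 : C) : z <> z0 -> near0 (fun h => z + h <> z0).
Proof.
intros hz; exists (Cmod (z - z0)); split.
- apply Cmod_gt_0; intros h0; apply hz.
  replace z with (z0 + (z - z0)) by ring; rewrite h0; ring.
- intros h hh he; replace (z - z0) with (- h) in hh.
  + rewrite Cmod_opp in hh; lra.
  + rewrite <- he; ring.
Qed.

Lemma slope_jet (f : C -> C) (z0 z : C) :
  analytic_on_disk f -> unit_disk z ->
  has_jet (slope f z0) z (C_derive (slope f z0) z).
Proof.
intros Hf hz; destruct (Ceq_dec z z0) as [<- | hn].
- exact (proj2 (analytic_jets f z Hf hz)).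
- assert (hd : z - z0 <> 0).
  { intros h0; apply hn; replace z with (z0 + (z - z0)) by ring.
    rewrite h0; ring. }
  assert (J1 := proj1 (analytic_jets f z Hf hz)).
  assert (J2 := jet_mult _ _ _ _ _
    (jet_plus _ _ _ _ _ J1 (jet_const (- f z0) z))
    (jet_inv _ _ _ (jet_plus _ _ _ _ _ (jet_id z) (jet_const (- z0) z)) hd)).
  eapply jet_self, jet_ext_loc with (2 := J2).
  apply near0_imp with (2 := near0_apart z z0 hn); intros h hh.
  unfold slope; destruct (Ceq_dec (z + h) z0); [tauto | reflexivity].
Qed.

Lemma Cmod_lt_1_neq (z : C) : (Cmod z < 1)%R -> 1 - z <> 0.
Proof.
intros hz h0; replace z with (RtoC 1) in hz.
- rewrite Cmod_1 in hz; lra.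
- replace z with (1 - (1 - z)) by ring; rewrite h0; ring.
Qed.

Lemma Cmod_one_minus_ge (z : C) : (1 - Cmod z <= Cmod (1 - z))%R.
Proof.
assert (H := Cmod_triangle (1 - z) z).
replace (1 - z + z) with (RtoC 1) in H by ring.
rewrite Cmod_1 in H; lra.
Qed.

Lemma Cmod_conj_mult_lt (a b : C) :
  (Cmod a < 1)%R -> (Cmod b < 1)%R -> (Cmod (Cconj a * b) < 1)%R.
Proof.
intros ha hb; rewrite Cmod_mult, Cmod_conj.
assert (h1 := Cmod_ge_0 a); assert (h2 := Cmod_ge_0 b); nra.
Qed.

Lemma mobius_identity (a b : C) :
  (Cmod (1 - Cconj a * b) ^ 2
   = Cmod (b - a) ^ 2 + (1 - Cmod a ^ 2) * (1 - Cmod b ^ 2))%R.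
Proof.
rewrite !Cmod2_alt; destruct a as [a1 a2], b as [b1 b2].
unfold Re, Im; simpl; ring.
Qed.

(** Two-point form of the Schwarz-Pick lemma.  The quotient [F] of the Moebius
    differences of [omega] and of the identity has only a removable
    singularity at [z0].  On [|w| = rho] the numerator has modulus at most 1,
    and the denominator tends to modulus 1 as [rho] tends to 1, so the
    maximum principle gives [|F| <= 1]. *)
Lemma schwarz_pick (omega : C -> C) (z0 z : C) :
  analytic_on_disk omega ->
  (forall w, unit_disk w -> unit_disk (omega w)) ->
  unit_disk z0 -> unit_disk z ->
  (Cmod (slope omega z0 z) * Cmod (1 - Cconj z0 * z)
   <= Cmod (1 - Cconj (omega z0) * omega z))%R.
Proof.
intros Ha Hmap hz0 hz.
assert (hw0 := Hmap z0 hz0).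
set (w0 := omega z0) in *.
assert (hden : forall w, unit_disk w -> 1 - Cconj w0 * omega w <> 0).
{ intros w hw; apply Cmod_lt_1_neq, Cmod_conj_mult_lt; trivial.
  exact (Hmap w hw). }
set (F := fun w => slope omega z0 w * (1 + - Cconj z0 * w)
                   * / (1 + - Cconj w0 * omega w)).
assert (HF : forall w, unit_disk w -> exists d, has_jet F w d).
{ intros w hw; eexists; unfold F.
  apply jet_mult; [apply jet_mult |].
  - apply (slope_jet omega z0 w Ha hw).
  - apply jet_plus; [apply jet_const |].
    apply jet_mult; [apply jet_const | apply jet_id].
  - apply jet_inv.
    + apply jet_plus; [apply jet_const |].
      apply jet_mult; [apply jet_const |].
      exact (proj1 (analytic_jets omega w Ha hw)).
    + intros h0; apply (hden w hw); rewrite <- h0; ring. }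
assert (HFm : forall w, unit_disk w ->
  (Cmod (F w) * Cmod (1 - Cconj w0 * omega w)
   = Cmod (slope omega z0 w) * Cmod (1 - Cconj z0 * w))%R).
{ intros w hw; rewrite <- !Cmod_mult; f_equal; unfold F; field.
  intros h0; apply (hden w hw); rewrite <- h0; ring. }
assert (Hle : (Cmod (F z) ^ 2 <= 1)%R).
{ unfold unit_disk in hz, hz0; apply le_epsilon; intros eps heps.
  (* On [|w| = rho] the squared denominator is [1 - t] with
     [t <= (1 - rho^2) k]; [rho >= 1 - c] makes [t <= e], and
     [1 / (1 - e) = 1 + eps]. *)
  set (k := ((1 + Cmod z0) / (1 - Cmod z0))%R).
  assert (h00 := Cmod_ge_0 z0).
  assert (hk : (0 < k)%R) by (apply Rdiv_lt_0_compat; lra).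
  assert (hk1 : (k * (1 - Cmod z0) = 1 + Cmod z0)%R) by (unfold k; field; lra).
  set (e := (eps / (1 + eps))%R).
  assert (he : (0 < e)%R) by (apply Rdiv_lt_0_compat; lra).
  assert (he1 : (e * (1 + eps) = eps)%R) by (unfold e; field; lra).
  assert (he2 : (e < 1)%R) by nra.
  set (c := (e / (2 * k))%R).
  assert (hc : (0 < c)%R) by (apply Rdiv_lt_0_compat; lra).
  assert (hc1 : (2 * c * k = e)%R) by (unfold c; field; lra).
  set (rho := Rmax (Cmod z) (Rmax ((1 + Cmod z0) / 2) (1 - c))).
  assert (hr1 : (Cmod z <= rho)%R) by apply Rmax_l.
  assert (hr2 : ((1 + Cmod z0) / 2 <= rho)%R).
  { unfold rho; eapply Rle_trans, Rmax_r; apply Rmax_l. }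
  assert (hr3 : (1 - c <= rho)%R).
  { unfold rho; eapply Rle_trans, Rmax_r; apply Rmax_r. }
  assert (hr4 : (rho < 1)%R) by (repeat apply Rmax_lub_lt; lra).
  clearbody rho.
  apply (maximum_modulus F rho); trivial; [lra | |].
  { intros w hw; apply HF; unfold unit_disk; lra. }
  intros w hw.
  assert (hwd : unit_disk w) by (unfold unit_disk; lra).
  assert (H1 := HFm w hwd).
  assert (H2 := slope_spec omega z0 w); fold w0 in H2.
  assert (H3 :
    (Cmod (omega w - w0) = Cmod (w - z0) * Cmod (slope omega z0 w))%R).
  { rewrite <- Cmod_mult, H2; f_equal; ring. }
  assert (I1 := mobius_identity z0 w); assert (I2 := mobius_identity w0 (omega w)).
  assert (hww := Hmap w hwd); unfold unit_disk in hww, hw0.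
  assert (g1 := Cmod_ge_0 (omega w)); assert (g2 := Cmod_ge_0 w0).
  rewrite hw in I1.
  assert (hA : (1 - Cmod z0 <= Cmod (1 - Cconj z0 * w))%R).
  { apply Rle_trans with (2 := Cmod_one_minus_ge _).
    rewrite Cmod_mult, Cmod_conj, hw; nra. }
  assert (hB :
    (Cmod (omega w - w0) ^ 2 <= Cmod (1 - Cconj w0 * omega w) ^ 2)%R).
  { rewrite I2.
    assert (0 <= (1 - Cmod w0 ^ 2) * (1 - Cmod (omega w) ^ 2))%R
      by (apply Rmult_le_pos; nra).
    lra. }
  assert (hB0 : (0 < Cmod (1 - Cconj w0 * omega w))%R)
    by (apply Cmod_gt_0, hden; trivial).
  rewrite H3 in hB.
  set (A := Cmod (1 - Cconj z0 * w)) in *.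
  set (B := Cmod (1 - Cconj w0 * omega w)) in *.
  set (s := Cmod (slope omega z0 w)) in *.
  set (x := Cmod (F w)) in *.
  set (t := Cmod (w - z0)) in *.
  assert (hD : (A ^ 2 * (1 - e) <= t ^ 2)%R).
  { assert (hl : ((1 - Cmod z0 ^ 2) * (1 - rho ^ 2) <= e * A ^ 2)%R); [| lra].
    replace (1 - Cmod z0 ^ 2)%R with (k * (1 - Cmod z0) ^ 2)%R.
    2:{ replace (k * (1 - Cmod z0) ^ 2)%R
          with (k * (1 - Cmod z0) * (1 - Cmod z0))%R by ring.
        rewrite hk1; ring. }
    assert (q1 : (1 - rho ^ 2 <= 2 * c)%R) by nra.
    assert (q2 : ((1 - Cmod z0) ^ 2 <= A ^ 2)%R) by (apply pow_incr; lra).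
    assert (q3 : (0 <= 1 - rho ^ 2)%R) by nra.
    apply Rle_trans with (k * A ^ 2 * (2 * c))%R.
    - apply Rmult_le_compat; trivial.
      + apply Rmult_le_pos; [lra | apply pow2_ge_0].
      + apply Rmult_le_compat_l; lra.
    - rewrite <- hc1; lra. }
  assert (hA0 : (0 < A)%R) by lra.
  assert (hx : (x ^ 2 * (1 - e) <= 1)%R).
  { apply (Rmult_le_reg_l (B ^ 2)); [apply pow_lt; trivial |].
    replace (B ^ 2 * (x ^ 2 * (1 - e)))%R with (s ^ 2 * (A ^ 2 * (1 - e)))%R.
    2:{ replace (s ^ 2 * (A ^ 2 * (1 - e)))%R with ((s * A) ^ 2 * (1 - e))%R by ring.
        rewrite <- H1; ring. }
    apply Rle_trans with (s ^ 2 * t ^ 2)%R; [| lra].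
    apply Rmult_le_compat_l; trivial; apply pow2_ge_0. }
  assert (h1e : ((1 - e) * (1 + eps) = 1)%R) by lra.
  apply (Rmult_le_reg_r (1 - e)); lra. }
rewrite <- HFm by trivial; fold w0.
assert (h1 := Cmod_ge_0 (F z)).
assert (h2 := Cmod_ge_0 (1 - Cconj w0 * omega z)).
assert (Cmod (F z) <= 1)%R by nra.
nra.
Qed.

Lemma schwarz_slope (omega : C -> C) (z : C) :
  analytic_on_disk omega ->
  (forall w, unit_disk w -> unit_disk (omega w)) -> omega 0 = 0 ->
  unit_disk z -> (Cmod (slope omega 0 z) <= 1)%R.
Proof.
intros Ha Hmap H0 hz.
assert (hd0 : unit_disk 0) by (unfold unit_disk; rewrite Cmod_0; lra).
assert (H := schwarz_pick omega 0 z Ha Hmap hd0 hz).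
rewrite H0 in H.
assert (E : forall w, 1 - Cconj 0 * w = 1).
{ intros w; apply injective_projections; simpl; ring. }
rewrite !E, Cmod_1 in H; lra.
Qed.

Lemma schwarz_pick_derive (omega : C -> C) (z : C) :
  analytic_on_disk omega ->
  (forall w, unit_disk w -> unit_disk (omega w)) -> unit_disk z ->
  (Cmod (C_derive omega z) * (1 - Cmod z ^ 2) <= 1 - Cmod (omega z) ^ 2)%R.
Proof.
intros Ha Hmap hz.
assert (H := schwarz_pick omega z z Ha Hmap hz hz).
assert (E : forall w, unit_disk w -> Cmod (1 - Cconj w * w) = (1 - Cmod w ^ 2)%R).
{ intros w hw; replace (1 - Cconj w * w) with (RtoC (1 - Cmod w ^ 2)%R).
  - rewrite Cmod_R; apply Rabs_pos_eq; unfold unit_disk in hw.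
    assert (h := Cmod_ge_0 w); nra.
  - rewrite Cmod2_alt; destruct w as [x y]; unfold Re, Im.
    apply injective_projections; simpl; ring. }
rewrite !E, slope_at in H by auto; exact H.
Qed.

(** * Recovering a derivative as a limit *)

Lemma jet_real_part_derive (F : C -> C) (z d c : C) (x : R) :
  has_jet F (z + x) d ->
  derivable_pt_lim (fun t : R => Re (c * F (z + t))) x (Re (c * d)).
Proof.
intros [b [E [HE HF]]] eps heps.
set (T := fun h => c * (b + h * E h)).
assert (hT : bounded_near0 T) by (unfold T; bounded).
destruct (near0_and _ _ HF (near0_mult_small T eps hT heps)) as [delta [hd H]].
exists (mkposreal _ hd); simpl; intros h hn hh.
destruct (H (RtoC h)) as [H1 H2]; [now rewrite Cmod_R |].
replace (z + (x + h)%R) with (z + x + h) by (rewrite RtoC_plus; ring).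
rewrite H1.
replace (_ - _)%R with (Re (h * T h)).
- apply Rle_lt_trans with (1 := re_le_Cmod _); exact H2.
- replace (h * T h) with ((c * (F (z + x) + d * h + b * h ^ 2 + h ^ 3 * E h)
     + - (c * F (z + x))) * / h + - (c * d)).
  + rewrite <- RtoC_inv by trivial.
    unfold Re; simpl; field; trivial.
  + unfold T; field; intros h0; apply hn; now apply RtoC_inj.
Qed.

(** If [F' = G] off [z] and [G] is continuous at [z], then [F'(z) = G z].  The
    mean value theorem along a horizontal segment, applied to the real part
    of [conj(k) (F(w) - G(z) w)] with [k = F'(z) - G(z)], forces
    [|k|^2 <= |k|^2 / 2]. *)
Lemma jet_derive_limit (F G : C -> C) (z d e : C) :
  has_jet F z d -> has_jet G z e ->
  near0 (fun h => h <> 0 -> has_jet F (z + h) (G (z + h))) ->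
  d = G z.
Proof.
intros HF HG Hd.
destruct (Ceq_dec (d - G z) 0) as [h0 | hn].
{ replace d with (G z + (d - G z)) by ring; rewrite h0; ring. }
exfalso; set (k := d - G z) in *.
assert (hk : (0 < Cmod k)%R) by now apply Cmod_gt_0.
destruct HF as [c [E [HE HF']]].
set (T := fun h => c + h * E h).
assert (hT : bounded_near0 T) by (unfold T; bounded).
assert (hk4 : (0 < Cmod k / 4)%R) by lra.
destruct (near0_and _ _ Hd (near0_and _ _ (jet_continuous G z e _ HG hk4)
  (near0_and _ _ HF' (near0_mult_small T _ hT hk4)))) as [delta [hdelta H]].
set (t := (delta / 2)%R).
assert (ht : (0 < t < delta)%R) by (unfold t; lra).
set (K := fun x : R => Re (Cconj k * (F (z + x) + - G z * (z + x)))).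
assert (HK : forall x d', has_jet F (z + RtoC x) d' ->
  is_derive K x (Re (Cconj k * (d' - G z)))).
{ intros x d' J; apply is_derive_Reals; unfold K.
  apply (jet_real_part_derive (fun w => F w + - G z * w)).
  replace (d' - G z) with (d' + (0 * (z + x) + - G z * 1)) by ring.
  apply jet_plus; trivial.
  apply (jet_mult (fun _ => - G z) (fun w => w)); [apply jet_const | apply jet_id]. }
assert (Hmod : forall x : R, (0 <= x <= t)%R -> (Cmod x < delta)%R).
{ intros x hx; rewrite Cmod_R, Rabs_pos_eq; lra. }
destruct (MVT_gen K 0 t (fun x => Re (Cconj k * (G (z + x) - G z))))
  as [xi [hxi Hxi]].
{ intros x; rewrite Rmin_left, Rmax_right by lra; intros hx.
  apply HK; destruct (H (RtoC x)) as [H1 _]; [apply Hmod; lra |].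
  apply H1; intros h0; apply RtoC_inj in h0; lra. }
{ intros x; rewrite Rmin_left, Rmax_right by lra; intros hx.
  apply continuity_pt_filterlim, (ex_derive_continuous K).
  destruct (Req_dec x 0) as [-> | hx0].
  - exists (Re (Cconj k * (d - G z))); apply HK.
    replace (z + 0) with z by ring; exists c, E; tauto.
  - eexists; apply HK; destruct (H (RtoC x)) as [H1 _]; [apply Hmod; lra |].
    apply H1; intros h0; apply RtoC_inj in h0; lra. }
rewrite Rmin_left, Rmax_right in hxi by lra.
destruct (H (RtoC xi) (Hmod xi hxi)) as [_ [H1 _]].
destruct (H (RtoC t) (Hmod t ltac:(lra))) as [_ [_ [H2 H3]]].
assert (Hl : (K t - K 0 = t * (Cmod k ^ 2 + Re (Cconj k * (t * T t))))%R).
{ unfold K; rewrite H2, Cmod2_alt, Cplus_0_r; unfold T.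
  replace d with (G z + k) by (unfold k; ring).
  destruct k as [k1 k2].
  unfold Re, Im; simpl; ring. }
assert (Hr : (Re (Cconj k * (G (z + xi)%C - G z)) <= Cmod k * (Cmod k / 4))%R).
{ apply Rle_trans with (1 := Rle_abs _), Rle_trans with (1 := re_le_Cmod _).
  rewrite Cmod_mult, Cmod_conj; apply Rmult_le_compat_l; lra. }
assert (Hs : (- (Cmod k * (Cmod k / 4)) <= Re (Cconj k * (t * T t)))%R).
{ assert (Ha : (Rabs (Re (Cconj k * (t * T t))) <= Cmod k * (Cmod k / 4))%R).
  { apply Rle_trans with (1 := re_le_Cmod _).
    rewrite Cmod_mult, Cmod_conj; apply Rmult_le_compat_l; lra. }
  apply Rabs_le_between in Ha; lra. }
rewrite Hl in Hxi.
assert (Heq : (Cmod k ^ 2 + Re (Cconj k * (t * T t))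
  = Re (Cconj k * (G (z + xi)%C - G z)))%R).
{ apply (Rmult_eq_reg_l t); lra. }
nra.
Qed.

(** * The function phi and its radial bounds *)

Definition den (alpha : R) (w : C) : C := (1 - w) * (3 + alpha * w).

Lemma phi_con_den (alpha : R) (w : C) : phi_con alpha w = 3 / den alpha w.
Proof. unfold phi_con, den; f_equal; ring. Qed.

Lemma Cmod_affine_ge (alpha : R) (w : C) :
  (alpha <= 0)%R -> (3 + alpha * Cmod w <= Cmod (3 + alpha * w))%R.
Proof.
intros ha.
assert (H := Cmod_triangle (3 + alpha * w) (- (alpha * w))).
replace (3 + alpha * w + - (alpha * w)) with (RtoC 3) in H by ring.
rewrite Cmod_opp, Cmod_mult, !Cmod_R in H.
rewrite (Rabs_pos_eq 3), (Rabs_left1 alpha) in H by lra; lra.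
Qed.

Lemma affine_neq_0 (alpha : R) (w : C) :
  (-3 < alpha <= 0)%R -> unit_disk w -> 3 + alpha * w <> 0.
Proof.
intros ha hw; apply Cmod_gt_0.
apply Rlt_le_trans with (2 := Cmod_affine_ge alpha w ltac:(lra)).
unfold unit_disk in hw; assert (h := Cmod_ge_0 w); nra.
Qed.

Lemma den_neq_0 (alpha : R) (w : C) :
  (-3 < alpha <= 0)%R -> unit_disk w -> den alpha w <> 0.
Proof.
intros ha hw; apply Cmult_neq_0.
- now apply Cmod_lt_1_neq.
- now apply affine_neq_0.
Qed.

(** [(phi(w) - 1) / w] with its singularity at 0 removed, in partial fractions
    so that the triangle inequality is sharp at [w = |w|]; likewise for
    [phi'/phi] below. *)
Definition psi_con (alpha : R) (w : C) : C :=
  / (1 - w) - alpha / ((1 - w) * (3 + alpha * w)).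

Definition dlog_phi_con (alpha : R) (w : C) : C :=
  / (1 - w) - alpha / (3 + alpha * w).

Lemma three_neq_0 : RtoC 3 <> 0.
Proof. intros h; apply RtoC_inj in h; lra. Qed.

Lemma phi_con_psi (alpha : R) (w : C) :
  (-3 < alpha <= 0)%R -> unit_disk w ->
  phi_con alpha w = 1 + w * psi_con alpha w.
Proof.
intros ha hw; rewrite phi_con_den; unfold den, psi_con.
field; split; [now apply affine_neq_0 | now apply Cmod_lt_1_neq].
Qed.

Lemma psi_con_bound (alpha : R) (w : C) :
  (-3 < alpha <= 0)%R -> unit_disk w ->
  (Cmod (psi_con alpha w)
   <= / (1 - Cmod w) - alpha / ((1 - Cmod w) * (3 + alpha * Cmod w)))%R.
Proof.
intros ha hw; unfold psi_con.
assert (h1 := Cmod_lt_1_neq w hw); assert (h2 := affine_neq_0 alpha w ha hw).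
assert (b1 := Cmod_one_minus_ge w).
assert (b2 := Cmod_affine_ge alpha w ltac:(lra)).
unfold unit_disk in hw; assert (b0 := Cmod_ge_0 w).
assert (b3 : (0 < 3 + alpha * Cmod w)%R) by nra.
apply Rle_trans with (1 := Cmod_triangle _ _).
rewrite Cmod_opp, Cmod_div, Cmod_inv, Cmod_mult, Cmod_R, Rabs_left1
  by (try apply Cmult_neq_0; trivial; lra).
unfold Rdiv; unfold Rminus; rewrite Ropp_mult_distr_l.
apply Rplus_le_compat.
- apply Rinv_le_contravar; lra.
- apply Rmult_le_compat_l; [lra |].
  apply Rinv_le_contravar; [apply Rmult_lt_0_compat; lra |].
  apply Rmult_le_compat; lra.
Qed.

Lemma dlog_phi_con_bound (alpha : R) (w : C) :
  (-3 < alpha <= 0)%R -> unit_disk w ->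
  (Cmod (dlog_phi_con alpha w)
   <= / (1 - Cmod w) - alpha / (3 + alpha * Cmod w))%R.
Proof.
intros ha hw; unfold dlog_phi_con.
assert (h1 := Cmod_lt_1_neq w hw); assert (h2 := affine_neq_0 alpha w ha hw).
assert (b1 := Cmod_one_minus_ge w).
assert (b2 := Cmod_affine_ge alpha w ltac:(lra)).
unfold unit_disk in hw; assert (b0 := Cmod_ge_0 w).
assert (b3 : (0 < 3 + alpha * Cmod w)%R) by nra.
apply Rle_trans with (1 := Cmod_triangle _ _).
rewrite Cmod_opp, Cmod_div, Cmod_inv, Cmod_R, Rabs_left1 by (trivial; lra).
unfold Rdiv; unfold Rminus; rewrite Ropp_mult_distr_l.
apply Rplus_le_compat.
- apply Rinv_le_contravar; lra.
- apply Rmult_le_compat_l; [lra |].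
  apply Rinv_le_contravar; lra.
Qed.

(** After clearing denominators the difference of the two sides has the factor
    [1 - r], so equality holds in the limit [r -> 1]; the cofactor is affine
    in [r] and positive at [r = 0] and [r = 1]. *)
Lemma radial_bound (alpha r : R) :
  (-3 < alpha <= 0)%R -> (0 <= r < 1)%R ->
  ((1 - r ^ 2) * (/ (1 - r) - alpha / (3 + alpha * r))
   + (1 - r ^ 2) * (/ (1 - r) - alpha / ((1 - r) * (3 + alpha * r)))
   <= 2 * (6 + alpha) / (3 + alpha))%R.
Proof.
intros ha hr.
assert (h1 : (0 < 3 + alpha * r)%R) by nra.
replace (_ + _)%R with
  ((1 + r) * (6 - 2 * alpha + 3 * alpha * r) / (3 + alpha * r))%R
  by (field; split; lra).
apply (proj2 (Rle_div_l _ _ _ h1)).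
replace (2 * (6 + alpha) / (3 + alpha) * (3 + alpha * r))%R
  with (2 * (6 + alpha) * (3 + alpha * r) / (3 + alpha))%R by (field; lra).
apply (proj1 (Rle_div_r _ _ (3 + alpha) ltac:(lra))).
assert (E : (2 * (6 + alpha) * (3 + alpha * r)
  - (1 + r) * (6 - 2 * alpha + 3 * alpha * r) * (3 + alpha)
  = (1 - r) * (18 + 6 * alpha + 2 * alpha ^ 2 + (9 * alpha + 3 * alpha ^ 2) * r))%R)
  by ring.
assert (P : (0 <= 18 + 6 * alpha + 2 * alpha ^ 2 + (9 * alpha + 3 * alpha ^ 2) * r)%R).
{ assert (9 * alpha + 3 * alpha ^ 2 <= 0)%R by nra.
  assert (0 <= 18 + 15 * alpha + 5 * alpha ^ 2)%R by nra.
  nra. }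
nra.
Qed.

(** * The representation of the pre-Schwarzian *)

Lemma disk_0 : unit_disk 0.
Proof. unfold unit_disk; rewrite Cmod_0; lra. Qed.

Lemma Cdiv_0_r (x : C) : x / 0 = 0.
Proof.
unfold Cdiv; replace (/ 0) with (RtoC 0); [ring |].
unfold Cinv; simpl; unfold Rdiv; apply injective_projections; simpl; ring.
Qed.

Section Representation.

Variables (alpha : R) (f omega : C -> C).
Hypotheses (ha : (-3 < alpha <= 0)%R) (Hf : class_A f)
  (Hom : analytic_on_disk omega)
  (Hmap : forall z, unit_disk z -> unit_disk (omega z)) (Hom0 : omega 0 = 0)
  (Hsub : forall z, unit_disk z ->
     starlike_quotient f z = phi_con alpha (omega z)).

Let p := slope f 0.
Let g := slope omega 0.

Lemma f_factor (z : C) : f z = z * p z.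
Proof.
destruct Hf as [_ [f0 _]].
rewrite (slope_spec f 0 z), f0; unfold p; ring.
Qed.

Lemma p_0 : p 0 = 1.
Proof. destruct Hf as [_ [_ f1]]; unfold p; now rewrite slope_at. Qed.

Lemma phi_omega_neq_0 (z : C) : unit_disk z -> phi_con alpha (omega z) <> 0.
Proof.
intros hz; rewrite phi_con_den; unfold Cdiv.
assert (h := den_neq_0 alpha _ ha (Hmap z hz)).
apply Cmult_neq_0; [exact three_neq_0 |].
intros h0; apply three_neq_0.
replace (RtoC 3) with (3 * (den alpha (omega z) * / den alpha (omega z)))
  by (rewrite Cinv_r by trivial; ring).
rewrite h0; ring.
Qed.

(** [phi] omits 0, whereas a zero of [f] would make the quotient
    [z f'(z) / f(z)] vanish, division by 0 being 0. *)
Lemma p_neq_0 (z : C) : unit_disk z -> p z <> 0.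
Proof.
intros hz h0; destruct (Ceq_dec z 0) as [-> | hn].
- rewrite p_0 in h0; apply RtoC_inj in h0; lra.
- apply (phi_omega_neq_0 z hz); rewrite <- Hsub by trivial.
  unfold starlike_quotient; destruct (Ceq_dec z 0); [tauto |].
  rewrite f_factor, h0, Cmult_0_r; apply Cdiv_0_r.
Qed.

(** This is how second derivatives become available: [f'] is expressed through
    functions whose jets are known, so its jet needs no termwise
    differentiation of power series. *)
Lemma derive_factor (z : C) :
  unit_disk z -> C_derive f z = phi_con alpha (omega z) * p z.
Proof.
intros hz; assert (H := Hsub z hz); unfold starlike_quotient in H.
rewrite <- H; destruct (Ceq_dec z 0) as [-> | hn].
- rewrite p_0; destruct Hf as [_ [_ ->]]; ring.
- rewrite f_factor; field; split; trivial; now apply p_neq_0.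
Qed.

Lemma p_jet (z : C) : unit_disk z -> has_jet p z (C_derive p z).
Proof. intros hz; exact (slope_jet f 0 z (proj1 Hf) hz). Qed.

Lemma omega_jet (z : C) : unit_disk z -> has_jet omega z (C_derive omega z).
Proof. intros hz; exact (proj1 (analytic_jets omega z Hom hz)). Qed.

Lemma inv_den_jet (z : C) : unit_disk z ->
  has_jet (fun w => / den alpha (omega w)) z
    (C_derive omega z * (dlog_phi_con alpha (omega z) / den alpha (omega z))).
Proof.
intros hz; assert (J := omega_jet z hz).
assert (h1 := Cmod_lt_1_neq _ (Hmap z hz)).
assert (h2 := affine_neq_0 alpha _ ha (Hmap z hz)).
assert (JD : has_jet (fun w => den alpha (omega w)) z
  ((0 + (0 * omega z + - (1) * C_derive omega z)) * (3 + alpha * omega z)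
   + (1 + - (1) * omega z) * (0 + (0 * omega z + alpha * C_derive omega z)))).
{ apply (jet_ext_loc (fun w => (1 + - (1) * omega w) * (3 + alpha * omega w))).
  - apply near0_imp with (2 := near0_small 1 Rlt_0_1); intros h _.
    unfold den; ring.
  - apply (jet_mult (fun w => 1 + - (1) * omega w) (fun w => 3 + alpha * omega w)).
    + apply (jet_plus (fun _ => RtoC 1)); [apply jet_const |].
      apply (jet_mult (fun _ => - (1))); [apply jet_const | trivial].
    + apply (jet_plus (fun _ => RtoC 3)); [apply jet_const |].
      apply (jet_mult (fun _ => RtoC alpha)); [apply jet_const | trivial]. }
assert (JI := jet_inv _ _ _ JD (den_neq_0 alpha _ ha (Hmap z hz))).
apply (jet_eq _ _ _ _ JI).
unfold den, dlog_phi_con; field; tauto.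
Qed.

(** Off 0 this is [z f'/f = phi(omega)] with [f = z p] and [omega = z g].  At 0
    dividing by [z] loses the information, and the identity is recovered by
    continuity of the right-hand side. *)
Lemma p_derive (z : C) : unit_disk z ->
  C_derive p z = p z * g z * psi_con alpha (omega z).
Proof.
set (G := fun z => p z * g z * psi_con alpha (omega z)).
assert (Hn : forall z, unit_disk z -> z <> 0 -> C_derive p z = G z).
{ clear z; intros z hz hn.
  assert (J := jet_mult _ _ _ _ _ (jet_id z) (p_jet z hz)).
  assert (D : C_derive f z = 1 * p z + z * C_derive p z).
  { apply jet_C_derive; apply jet_ext_loc with (2 := J).
    apply near0_imp with (2 := near0_small 1 Rlt_0_1); intros h _.
    now rewrite f_factor. }
  rewrite derive_factor, phi_con_psi in D by auto.
  assert (ho := slope_spec omega 0 z); rewrite Hom0 in ho; fold g in ho.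
  unfold G.
  replace (C_derive p z) with ((1 * p z + z * C_derive p z - p z) / z)
    by (field; trivial).
  rewrite <- D.
  replace (1 + omega z * psi_con alpha (omega z))
    with (1 + (0 + (z - 0) * g z) * psi_con alpha (omega z)) by now rewrite <- ho.
  field; trivial. }
intros hz; destruct (Ceq_dec z 0) as [-> | hn]; [| now apply Hn].
assert (JG : exists e, has_jet G 0 e).
{ assert (J1 := p_jet 0 disk_0); assert (J2 := slope_jet omega 0 0 Hom disk_0).
  assert (J3 := inv_den_jet 0 disk_0).
  assert (J := jet_mult _ _ _ _ _ (jet_mult _ _ _ _ _ J1 J2)
    (jet_mult _ _ _ _ _ (jet_plus _ _ _ _ _ (jet_const (3 - alpha) 0)
      (jet_mult _ _ _ _ _ (jet_const alpha 0) (omega_jet 0 disk_0))) J3)).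
  eexists; apply jet_ext_loc with (2 := J).
  apply near0_imp with (2 := disk_near 0 disk_0); intros h hh.
  unfold G, psi_con, den; fold p g; field; split.
  - now apply affine_neq_0; auto.
  - now apply Cmod_lt_1_neq, Hmap. }
destruct JG as [e JG].
apply (jet_derive_limit p G 0 _ e (p_jet 0 disk_0) JG).
apply near0_imp with (2 := disk_near 0 disk_0); intros h hh hn.
rewrite <- Hn; trivial; [now apply p_jet |].
now rewrite Cplus_0_l.
Qed.

(** Logarithmic derivative of [f' = phi(omega) p].  Taking [p'/p] from
    [p_derive] keeps the formula uniform at [z = 0]. *)
Lemma pre_schwarzian_representation (z : C) : unit_disk z ->
  pre_schwarzian f z = C_derive omega z * dlog_phi_con alpha (omega z)
                       + g z * psi_con alpha (omega z).
Proof.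
intros hz; unfold pre_schwarzian.
assert (Hnear : near0 (fun h =>
  3 * (/ den alpha (omega (z + h)) * p (z + h)) = C_derive f (z + h))).
{ apply near0_imp with (2 := disk_near z hz); intros h hh.
  rewrite derive_factor, phi_con_den by trivial; unfold Cdiv.
  apply Cmult_assoc. }
assert (J := jet_mult _ _ _ _ _ (jet_const 3 z)
  (jet_mult _ _ _ _ _ (inv_den_jet z hz) (p_jet z hz))).
rewrite (jet_C_derive (C_derive f) z _ (jet_ext_loc _ _ _ _ Hnear J)),
  derive_factor, phi_con_den, p_derive by trivial.
assert (hd := den_neq_0 alpha _ ha (Hmap z hz)).
assert (hp := p_neq_0 z hz).
field; repeat split; trivial; exact three_neq_0.
Qed.

Lemma pre_schwarzian_bound (z : C) : unit_disk z ->
  ((1 - Cmod z ^ 2) * Cmod (pre_schwarzian f z)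
   <= 2 * (6 + alpha) / (3 + alpha))%R.
Proof.
intros hz; rewrite pre_schwarzian_representation by trivial.
assert (hw := Hmap z hz).
assert (S1 := schwarz_slope omega z Hom Hmap Hom0 hz); fold g in S1.
assert (S2 := schwarz_pick_derive omega z Hom Hmap hz).
assert (B1 := dlog_phi_con_bound alpha _ ha hw).
assert (B2 := psi_con_bound alpha _ ha hw).
assert (hle : (Cmod (omega z) <= Cmod z)%R).
{ rewrite (slope_spec omega 0 z), Hom0; fold g.
  replace (0 + (z - 0) * g z) with (z * g z) by ring.
  rewrite Cmod_mult; generalize (Cmod_ge_0 z); nra. }
unfold unit_disk in hz, hw.
assert (w0 := Cmod_ge_0 (omega z)).
apply Rle_trans with (2 := radial_bound alpha (Cmod (omega z)) ha (conj w0 hw)).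
apply Rle_trans with ((1 - Cmod z ^ 2) *
  (Cmod (C_derive omega z) * Cmod (dlog_phi_con alpha (omega z))
   + Cmod (g z) * Cmod (psi_con alpha (omega z))))%R.
{ apply Rmult_le_compat_l; [nra |].
  rewrite <- !Cmod_mult; apply Cmod_triangle. }
rewrite Rmult_plus_distr_l; apply Rplus_le_compat.
(* Schwarz-Pick trades [1 - |z|^2] for [1 - |omega z|^2] in the first term;
   in the second this is Schwarz' inequality [|omega z| <= |z|]. *)
- rewrite <- Rmult_assoc; apply Rmult_le_compat; trivial; try apply Cmod_ge_0.
  + apply Rmult_le_pos; [nra | apply Cmod_ge_0].
  + lra.
- apply Rmult_le_compat.
  + nra.
  + apply Rmult_le_pos; apply Cmod_ge_0.
  + nra.
  + apply Rle_trans with (2 := B2).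
    generalize (Cmod_ge_0 (psi_con alpha (omega z))); nra.
Qed.

End Representation.

Theorem corollary4p3 (alpha : R) (f : C -> C)
  (Halpha : (-3 < alpha <= 0)%R) (Hf : Sstar_con alpha f) :
  Rbar_le (pre_schwarzian_norm f) (Finite (2 * (6 + alpha) / (3 + alpha))%R).
Proof.
destruct Hf as [HA [omega [Hom [Hmap [Hom0 Hsub]]]]].
apply Lub_Rbar_correct; intros x [z [hz ->]]; simpl.
now apply (pre_schwarzian_bound alpha f omega).
Qed.
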